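(* There exist a function $\omega:\mathbf{N}\to(0,\infty)$ with $\omega(n)\to\infty$ as $n\to\infty$ and an absolute constant $c>0$ with $$\omega(n)\geqslant c\,\frac{\sqrt{\log\log\log n}}{\log\log\log\log n}\quad\text{for all sufficiently large } n,$$ such that for every prime $p$ we have $m(p)\geqslant \omega(p)\log p$. In particular, for every prime $p$, every subset $B\subset \mathbf{Z}/p\mathbf{Z}$ with $|B|<\omega(p)\log p$ has a unique sum.
   Context: Let $G$ be an abelian group and $A\subset G$. We say that $A$ has a unique sum if there exist $a_1,a_2\in A$ such that the only solutions $(x,y)\in A^2$ of $x+y=a_1+a_2$ are $(x,y)=(a_1,a_2)$ and $(x,y)=(a_2,a_1)$. For a finite abelian group $G$, $m(G)$ denotes the size of the smallest subset of $G$ that has no unique sum, and $m(p)$ denotes $m(\mathbf{Z}/p\mathbf{Z})$. Equivalently, the statement $m(p)\geqslant\omega(p)\log p$ means that every subset of $\mathbf{Z}/p\mathbf{Z}$ having no unique sum has size at least $\omega(p)\log p$. *)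

(* Defs.v *)
From mathcomp Require Import all_boot all_algebra.
From Stdlib Require Import Reals.
Set Implicit Arguments. Unset Strict Implicit. Unset Printing Implicit Defensive.

Section UniqueSum.
Local Open Scope ring_scope.

Definition has_unique_sum (G : finZmodType) (A : {set G}) : Prop :=
  exists a1 a2 : G, [/\ a1 \in A, a2 \in A &
    forall x y : G, x \in A -> y \in A -> x + y = a1 + a2 ->
      (x = a1 /\ y = a2) \/ (x = a2 /\ y = a1)].
End UniqueSum.

(* Main.v *)
(* Suppose B has no unique sum and |B| = K log p. Say that b and t are V-close when
   b - t is a short combination of elements of a small set V, and cover B by
   the cells of V-close points around a set T of centres. Dirichlet approximation
   makes V tiny after a dilation, which orders each cell; the tops a, b of two cells
   then have a + b = c + d with c, d not in those same two cells. A second dilation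
   makes V tiny and boundedly many log p further points small, so B would lie in a
   short arc (and its largest element would give a unique sum) if few centres
   determined all the others through such relations. A random set S of centres
   determines every centre having many disjoint relations, hence some centre t has
   relations all meeting a bounded set C of centres. Adding the differences C - t to
   V brings almost every centre close to another one, and T can be thinned by a
   positive proportion of log p. After O(K) such steps T is exhausted, unless K is at
   least a power of log p; this is far more than the theorem requires. *)

Require Import Defs.
From mathcomp Require Import all_boot all_algebra.
From mathcomp Require Import perm zify ring.
Set Implicit Arguments. Unset Strict Implicit. Unset Printing Implicit Defensive.
Import GRing.Theory.

(** * Counting and random sampling *)

(** Independence of events that depend on complementary sets of coordinates, in counting form.
    Exchanging the values of two functions off [D] is an involution on pairs; the preimage of [P]
    times [P'] under it is [P && P'] times everything. *)
Lemma card_indep (X Y : finType) (D : {set X}) (P P' : pred {ffun X -> Y}) :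
    (forall f g : {ffun X -> Y}, {in D, f =1 g} -> P f = P g) ->
    (forall f g : {ffun X -> Y}, {in ~: D, f =1 g} -> P' f = P' g) ->
  #|[pred f | P f && P' f]| * #|{: {ffun X -> Y}}| = #|P| * #|P'|.
Proof.
move=> PD P'D.
pose mix (f g : {ffun X -> Y}) := [ffun x => if x \in D then f x else g x].
pose h (u : {ffun X -> Y} * {ffun X -> Y}) := (mix u.1 u.2, mix u.2 u.1).
have hK : involutive h.
  by case=> f g; congr pair; apply/ffunP=> x; rewrite !ffunE /=; case: ifP; rewrite ?ffunE => ->.
have hP : h @^-1: setX [set f | P f] [set f | P' f]
        = setX [set f | P f && P' f] [set: {ffun X -> Y}].
  apply/setP=> -[f g]; rewrite !inE /= andbT; congr (_ && _).
    by apply: PD => x xD; rewrite ffunE xD.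
  by apply: P'D => x; rewrite inE ffunE => /negbTE->.
have := card_preimset (setX [set f | P f] [set f | P' f]) (inv_inj hK).
by rewrite hP !cardsX cardsT !cardsE.
Qed.

(** For uniformly random [f] this is a random set containing each point independently with
    probability 1/(Q+1), so that probabilities become ratios of cardinals. *)
Definition zeros (X : finType) (Q : nat) (f : {ffun X -> 'I_Q.+1}) : {set X} :=
  [set x | f x == ord0].

Definition avoids (X : finType) (es : seq {set X}) (S : {set X}) : bool :=
  all (fun e : {set X} => ~~ (e \subset S)) es.

Definition disjoint_family (X : finType) (es : seq {set X}) : bool :=
  pairwise (fun e e' : {set X} => [disjoint e & e']) es.

Lemma card_zero_at (X : finType) (Q : nat) (x : X) :
  Q.+1 * #|[pred f : {ffun X -> 'I_Q.+1} | f x == ord0]|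
  = #|{: {ffun X -> 'I_Q.+1}}|.
Proof.
have F (i : 'I_Q.+1) : #|[pred f : {ffun X -> 'I_Q.+1} | f x == i]|
                      = #|[pred f : {ffun X -> 'I_Q.+1} | f x == ord0]|.
  (* Transposing [i] and [ord0] at the coordinate [x] alone matches the two fibres. *)
  pose h (f : {ffun X -> 'I_Q.+1}) :=
    [ffun y => if y == x then tperm i ord0 (f y) else f y].
  have hK : involutive h.
    move=> f; apply/ffunP=> y; rewrite !ffunE.
    by case: (y == x) => //; rewrite tpermK.
  have := card_preimset [set f : {ffun X -> 'I_Q.+1} | f x == ord0] (inv_inj hK).
  rewrite [X in _ = X -> _]cardsE => <-; apply: eq_card => f.
  rewrite !inE ffunE eqxx.
  by rewrite -(inj_eq (@perm_inj _ (tperm i ord0)) (f x) i) tpermL.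
rewrite -[RHS]sum1_card (partition_big (fun f : {ffun X -> 'I_Q.+1} => f x) predT) //=.
rewrite (eq_bigr (fun=> #|[pred f : {ffun X -> 'I_Q.+1} | f x == ord0]|)); last first.
  by move=> i _; rewrite -(F i) -sum1_card; apply: eq_bigl => f; rewrite inE.
by rewrite sum_nat_const card_ord.
Qed.

Lemma card_zero_on (X : finType) (Q : nat) (e : {set X}) :
  Q.+1 ^ #|e| * #|[pred f : {ffun X -> 'I_Q.+1} | e \subset zeros f]|
  = #|{: {ffun X -> 'I_Q.+1}}|.
Proof.
have total_gt0 : 0 < #|{: {ffun X -> 'I_Q.+1}}|.
  by apply/card_gt0P; exists [ffun=> ord0].
move ek: #|e| => k; elim: k e ek => [|k IH] e ek.
  rewrite mul1n; apply: eq_card => f; rewrite !inE.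
  by move/cards0_eq: ek => ->; rewrite sub0set.
have [x xe] : exists x, x \in e by apply/card_gt0P; rewrite ek.
have e1k : #|e :\ x| = k by move: ek; rewrite (cardsD1 x) xe add1n => -[].
pose P1 := [pred f : {ffun X -> 'I_Q.+1} | f x == ord0].
pose P2 := [pred f : {ffun X -> 'I_Q.+1} | e :\ x \subset zeros f].
have P1x (f g : {ffun X -> 'I_Q.+1}) : {in [set x], f =1 g} -> P1 f = P1 g.
  by move=> /(_ x) fg; rewrite /= fg ?inE.
have P2x (f g : {ffun X -> 'I_Q.+1}) : {in ~: [set x], f =1 g} -> P2 f = P2 g.
  move=> fg; rewrite /=; apply/subsetP/subsetP => H y ye; have := H y ye;
  by rewrite !inE fg // !inE; move: ye; rewrite !inE => /andP[].
have := card_indep P1x P2x.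
set N := #|_|; have -> : N = #|[pred f : {ffun X -> 'I_Q.+1} | e \subset zeros f]|.
  by apply: eq_card => f; rewrite !inE -{2}(setD1K xe) subUset sub1set inE.
move=> indep; apply/eqP; rewrite -(eqn_pmul2r total_gt0) -mulnA indep.
have e0 := card_zero_at Q x; have e1 := IH _ e1k.
by rewrite expnS mulnACA e0 e1.
Qed.

(** Put w = (Q+1)^3. A set of at most 3 points lies in [zeros f] with probability at least 1/w, and
    disjoint sets behave independently, so all of them are avoided with probability at most (1 -
    1/w)^(size es). Denominators are cleared. *)
Lemma card_avoids (X : finType) (Q : nat) (es : seq {set X}) :
    disjoint_family es -> all (fun e : {set X} => #|e| <= 3) es ->
  (Q.+1 ^ 3) ^ size es * #|[pred f : {ffun X -> 'I_Q.+1} | avoids es (zeros f)]|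
  <= (Q.+1 ^ 3).-1 ^ size es * #|{: {ffun X -> 'I_Q.+1}}|.
Proof.
have total_gt0 : 0 < #|{: {ffun X -> 'I_Q.+1}}|.
  by apply/card_gt0P; exists [ffun=> ord0].
move ew: (Q.+1 ^ 3) => w; elim: es => [|e es IH]; first by rewrite !mul1n => _ _; exact: max_card.
rewrite /disjoint_family /= => /andP[e_es /IH{}IH] /andP[e3 /IH{}IH].
pose P1 := [pred f : {ffun X -> 'I_Q.+1} | ~~ (e \subset zeros f)].
pose P2 := [pred f : {ffun X -> 'I_Q.+1} | avoids es (zeros f)].
have P1x (f g : {ffun X -> 'I_Q.+1}) : {in e, f =1 g} -> P1 f = P1 g.
  by move=> fg; congr negb; apply/subsetP/subsetP => H y ye; have := H y ye;
    rewrite !inE fg.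
have P2x (f g : {ffun X -> 'I_Q.+1}) : {in ~: e, f =1 g} -> P2 f = P2 g.
  move=> fg; apply: eq_in_all => e' e'es; congr negb.
  have /pred0P dis := allP e_es e' e'es.
  have fg' y : y \in e' -> f y = g y.
    by move=> ye; apply: fg; rewrite inE; have := dis y; rewrite /= ye andbT => ->.
  by apply/subsetP/subsetP => H y ye; have := H y ye; rewrite !inE fg'.
have := card_indep P1x P2x; set tot := #|{: {ffun X -> 'I_Q.+1}}| in IH total_gt0 *.
have -> : #|[pred f : {ffun X -> 'I_Q.+1} | avoids (e :: es) (zeros f)]| =
          #|[pred f | P1 f && P2 f]| by [].
move=> indep.
have P1le : (Q.+1 ^ 3) * #|P1| <= (Q.+1 ^ 3).-1 * tot.
  have eZ := card_zero_on Q e; rewrite -/tot in eZ.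
  have ZN := cardC [pred f : {ffun X -> 'I_Q.+1} | e \subset zeros f].
  have eP1 : #|[predC [pred f : {ffun X -> 'I_Q.+1} | e \subset zeros f]]| = #|P1| by [].
  rewrite eP1 -/tot in ZN.
  have : tot <= Q.+1 ^ 3 * #|[pred f : {ffun X -> 'I_Q.+1} | e \subset zeros f]|.
    by rewrite -eZ leq_mul2r leq_pexp2l ?orbT.
  have : 0 < Q.+1 ^ 3 by rewrite expn_gt0.
  move: ZN; clear; move: (Q.+1 ^ 3) #|P1| => w b.
  move: tot #|_| => a c.
  by case: w => [|w] //= <- _; rewrite !mulnDr; lia.
rewrite -(leq_pmul2r total_gt0) -mulnA indep; rewrite ew in P1le.
rewrite [size _]/= !expnS mulnACA.
by apply: leq_trans (leq_mul P1le IH) _; rewrite mulnACA mulnA.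
Qed.

Lemma leq_expnS_bernoulli a k : a ^ k.+1 + k.+1 * a ^ k <= a.+1 ^ k.+1.
Proof.
elim: k => [|k IH]; first by rewrite !expn1 expn0; lia.
rewrite [a.+1 ^ _]expnS; apply: leq_trans (leq_mul (leqnn a.+1) IH).
by rewrite !expnS; move: (a ^ k) => x; nia.
Qed.

Lemma expn_pred_half m : 0 < m -> 2 * m.-1 ^ m <= m ^ m.
Proof.
case: m => // m _ /=; apply: leq_trans (leq_expnS_bernoulli m m).
by rewrite expnS; lia.
Qed.

(** This fixes the number (Q+1)^4 = w(Q+1) of disjoint sets: (1 - 1/w)^w is at most 1/2, and 2^(Q+1)
    exceeds Q+1. *)
Lemma sampling_power Q : Q.+1 * (Q.+1 ^ 3).-1 ^ (Q.+1 ^ 4) <= (Q.+1 ^ 3) ^ (Q.+1 ^ 4).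
Proof.
have w_gt0 : 0 < Q.+1 ^ 3 by rewrite expn_gt0.
rewrite [Q.+1 ^ 4]expnSr; move: (Q.+1 ^ 3) w_gt0 => w /expn_pred_half h.
rewrite !expnM; apply: (@leq_trans ((2 * w.-1 ^ w) ^ Q.+1)); last by rewrite leq_exp2r.
by rewrite expnMn leq_mul2r (ltnW (ltn_expl _ _)) ?orbT.
Qed.

(** First moment method: a point of [T] is sampled with probability 1/(Q+1), and a point of [W] has
    all its sets avoided with probability at most 1/(Q+1). Some [S] does no worse than the
    average. *)
Lemma sampling (X : finType) (Q : nat) (T W : {set X}) (es : X -> seq {set X}) :
    W \subset T ->
    {in W, forall t, [/\ size (es t) = Q.+1 ^ 4, disjoint_family (es t)
                       & all (fun e : {set X} => #|e| <= 3) (es t)]} ->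
  exists S : {set X},
    Q.+1 * (#|T :&: S| + #|[set t in W | avoids (es t) S]|) <= 2 * #|T|.
Proof.
move=> WT esP.
pose tot := #|{: {ffun X -> 'I_Q.+1}}|.
have total_gt0 : 0 < tot by apply/card_gt0P; exists [ffun=> ord0].
pose F (f : {ffun X -> 'I_Q.+1}) :=
  #|T :&: zeros f| + #|[set t in W | avoids (es t) (zeros f)]|.
suff [f Ff] : exists f, Q.+1 * F f <= 2 * #|T| by exists (zeros f).
apply/existsP; apply: contraT; rewrite negb_exists => /forallP big.
suff : Q.+1 * \sum_f F f <= 2 * #|T| * tot.
  rewrite leqNgt big_distrr /= => /negP[].
  apply: (@leq_trans (\sum_(f : {ffun X -> 'I_Q.+1}) (2 * #|T|).+1)).
    by rewrite sum_nat_const [ltnLHS]mulnC ltn_pmul2l.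
  by apply: leq_sum => f _; rewrite ltnNge big.
have swap (A : {set X}) (P : X -> {ffun X -> 'I_Q.+1} -> bool) :
    \sum_f #|[set t in A | P t f]| = \sum_(t in A) #|[pred f | P t f]|.
  rewrite (eq_bigr (fun f => \sum_(t in A | P t f) 1)) => [|f _]; last first.
    by rewrite -sum1_card; apply: eq_bigl => t; rewrite inE.
  rewrite (exchange_big_dep (mem A)) /= => [|f t _ /andP[] //].
  by apply: eq_bigr => t tA; rewrite -sum1_card; apply: eq_bigl => f; rewrite inE tA.
rewrite big_split /= mulnDr -mulnA mul2n -addnn leq_add //.
  have -> : \sum_(f : {ffun X -> 'I_Q.+1}) #|T :&: zeros f|
          = \sum_(f : {ffun X -> 'I_Q.+1}) #|[set t in T | f t == ord0]|.
    by apply: eq_bigr => f _; apply: eq_card => t; rewrite !inE.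
  rewrite (swap T (fun t f => f t == ord0)) big_distrr /= -sum_nat_const.
  by apply: leq_sum => t _; rewrite card_zero_at.
rewrite (swap W (fun t f => avoids (es t) (zeros f))) big_distrr /=; apply: (@leq_trans (#|W| * tot)); last first.
  by rewrite leq_mul2r subset_leq_card ?orbT.
rewrite -sum_nat_const; apply: leq_sum => t tW.
have [esQ dis le3] := esP t tW.
have := card_avoids Q dis le3; rewrite -/tot esQ.
set N := #|_| => h.
have e3 : 0 < (Q.+1 ^ 3) ^ (Q.+1 ^ 4) by rewrite !expn_gt0.
rewrite -(leq_pmul2l e3) mulnCA.
apply: (leq_trans (leq_mul (leqnn Q.+1) h)).
by rewrite mulnA leq_mul2r sampling_power orbT.
Qed.

(** Greedy choice: either some member of [F] is disjoint from the sets already chosen and extends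
    the family, or their union meets every member. *)
Lemma matching_or_cover (X : finType) (F : pred {set X}) (d k : nat) :
    (forall e, F e -> #|e| <= d) ->
  (exists es, [/\ size es = k, disjoint_family es & all F es]) \/
  (exists C : {set X}, #|C| <= d * k /\ forall e, F e -> ~~ [disjoint e & C]).
Proof.
move=> Fd; elim: k => [|k [[es [esk dis esF]]|[C [Ck hit]]]]; first by left; exists [::].
  pose C := \bigcup_(e <- es) e.
  have [/forallP hit|] := boolP [forall e, F e ==> ~~ [disjoint e & C]].
    right; exists C; split; last by move=> e; apply/implyP/hit.
    have : #|C| <= d * size es.
      rewrite /C; elim: es {esk dis hit C} esF => [|e es IH] /=; first by rewrite big_nil cards0.
      case/andP=> /Fd ed /IH; rewrite big_cons; have := (leq_card_setU e (\bigcup_(j <- es) j)).1.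
      by rewrite mulnS; lia.
    by rewrite esk mulnS; lia.
  rewrite negb_forall => /existsP[e]; rewrite negb_imply negbK => /andP[Fe eC].
  left; exists (e :: es); split=> /=; rewrite ?esk ?Fe //.
  rewrite /disjoint_family /= [pairwise _ _]dis andbT; apply/allP => e' e'es.
  apply: disjointWr eC; rewrite /C; by rewrite bigcup_seq; apply: bigcup_sup.
by right; exists C; split=> //; rewrite mulnS; lia.
Qed.

Lemma large_shifted_subset (X : finType) (U : {set X}) (f : X -> X) :
    {in U, forall u, f u != u} ->
  exists A : {set X}, [/\ A \subset U, #|U| <= 3 * #|A| & {in A, forall a, f a \notin A}].
Proof.
move=> fU.
pose P (A : {set X}) := (A \subset U) && [forall a in A, f a \notin A].
have P0 : P set0 by rewrite /P sub0set; apply/forall_inP => a; rewrite inE.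
have [A /maxsetP[/andP[AU /forall_inP fA] Amax] _] := maxset_exists P0.
have [le|lt] := leqP #|U| (3 * #|A|); first by exists A.
(* A maximal [A] can be small if most of [U] is mapped into it; its preimage then serves. By
   maximality [U] is covered by [A], its image and its preimage, and the first two have at most
   [2 * #|A|] elements. *)
pose A2 := [set u in U | f u \in A].
exists A2; split; first by apply/subsetP => u; rewrite inE => /andP[].
  have : U \subset A :|: (f @: A) :|: A2.
    apply/subsetP => u uU; rewrite !inE uU /=; apply: contraT.
    rewrite !negb_or => /andP[/andP[uA ufA] fuA].
    suff e : u |: A = A by rewrite -e setU11 in uA.
    apply: Amax (subsetUr _ _); rewrite /P subUset sub1set uU AU /=.
    apply/forall_inP => a; rewrite !inE negb_or => /predU1P[->|aA].
      by rewrite fU.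
    by rewrite fA // andbT; apply: contraNneq ufA => <-; rewrite imset_f.
  move=> /subset_leq_card; have := (leq_card_setU (A :|: f @: A) A2).1.
  have := (leq_card_setU A (f @: A)).1; have := leq_imset_card f A.
  lia.
move=> a; rewrite !inE => /andP[aU faA]; apply/negP => /andP[_].
by apply/negP; exact: fA.
Qed.

(** * Approximation in Z/pZ *)

Local Open Scope ring_scope.

(** Distance to 0 on the circle Z/pZ. Writing the modulus as [q.+2] gives ['I_q.+2] its ring
    structure without side conditions. *)
Definition circ_norm (q : nat) (x : 'I_q.+2) : nat := minn x (q.+2 - x).

Lemma circ_norm0 q : circ_norm (0 : 'I_q.+2) = 0%N.
Proof. by rewrite /circ_norm min0n. Qed.

Lemma circ_normN q (x : 'I_q.+2) : circ_norm (- x) = circ_norm x.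
Proof.
rewrite /circ_norm /=; have := ltn_ord x; case: (posnP x) => [->|x_gt0] xq.
  by rewrite subn0 modnn.
by rewrite modn_small; lia.
Qed.

Lemma circ_normD q (x y : 'I_q.+2) : (circ_norm (x + y)%R <= circ_norm x + circ_norm y)%N.
Proof.
rewrite /circ_norm /=; have := ltn_ord x; have := ltn_ord y.
have [lt|ge] := ltnP (x + y) q.+2; first by rewrite modn_small //; lia.
move=> yq xq; have -> : ((x + y) %% q.+2 = x + y - q.+2)%N; last by lia.
by rewrite -{1}(subnK ge) modnDr modn_small; lia.
Qed.

Lemma circ_norm_sub q (x y : 'I_q.+2) : (y <= x)%N -> (circ_norm (x - y)%R <= x - y)%N.
Proof.
move=> yx; rewrite /circ_norm; apply: leq_trans (geq_minl _ _) _ => /=.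
have [->|y_gt0] := posnP y; first by rewrite subn0 modnn addn0 modn_small ?subn0.
rewrite (modn_small (m := (q.+2 - y)%N)); last by lia.
have -> : (x + (q.+2 - y) = (x - y) + q.+2)%N by have := ltn_ord y; lia.
by rewrite modnDr leq_mod.
Qed.

(** Adding [h] before taking the representative sends the arc of radius [h] around 0 to the integers
    from 0 to [2 * h], which orders the arc. *)
Definition shifted_lift (q h : nat) (x : 'I_q.+2) : nat := (x + h) %% q.+2.

Lemma shifted_lift_inj q h : injective (@shifted_lift q h).
Proof.
move=> x y /eqP; rewrite /shifted_lift eqn_modDr !modn_small // => /eqP; exact: val_inj.
Qed.

Lemma shifted_lift_le q h (x : 'I_q.+2) :
  (4 * h < q.+2)%N -> (circ_norm x <= h)%N -> (shifted_lift h x <= 2 * h)%N.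
Proof.
rewrite /circ_norm /shifted_lift geq_min => hq near; have xq := ltn_ord x.
have [lt|ge] := ltnP (x + h) q.+2; first by rewrite modn_small //; lia.
by rewrite -[in leqLHS](subnK ge) modnDr modn_small; lia.
Qed.

(** Sums of two lifts are at most [4 * h], hence do not wrap around: equality modulo [q.+2] is
    equality of integers, and neither term can then drop. *)
Lemma shifted_lift_dominated q h (x1 x2 y1 y2 : 'I_q.+2) : (4 * h < q.+2)%N ->
    (circ_norm x1 <= h)%N -> (circ_norm x2 <= h)%N ->
    (circ_norm y1 <= h)%N -> (circ_norm y2 <= h)%N ->
    y1 + y2 = x1 + x2 ->
    (shifted_lift h y1 <= shifted_lift h x1)%N ->
    (shifted_lift h y2 <= shifted_lift h x2)%N ->
  y1 = x1 /\ y2 = x2.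
Proof.
move=> hq nx1 nx2 ny1 ny2 e le1 le2.
have lx1 := shifted_lift_le hq nx1; have lx2 := shifted_lift_le hq nx2.
have ly1 := shifted_lift_le hq ny1; have ly2 := shifted_lift_le hq ny2.
have eS : (shifted_lift h y1 + shifted_lift h y2 =
           shifted_lift h x1 + shifted_lift h x2)%N.
  rewrite -[LHS](@modn_small _ q.+2); last by lia.
  rewrite -[RHS](@modn_small _ q.+2); last by lia.
  rewrite /shifted_lift !modnDm ![(_ + h + _)%N]addnACA -modnDml -[in RHS]modnDml.
  by have /(congr1 val)/= -> := e.
by split; apply: (@shifted_lift_inj q h); lia.
Qed.

Lemma mul_ord_prime_inj q (l : 'I_q.+2) : prime q.+2 -> l != 0 -> injective ( *%R l).
Proof.
move=> pq l0 x y e; apply/eqP; rewrite -subr_eq0.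
have : (q.+2 %| l * (x - y)%R)%N.
  have : l * (x - y) = 0 by rewrite mulrBr e subrr.
  by move/(congr1 val) => /= /eqP.
have small (z : 'I_q.+2) : (q.+2 %| z)%N -> z = 0.
  by rewrite /dvdn modn_small // => /eqP z0; apply: val_inj.
by rewrite Euclid_dvdM // => /orP[/small/eqP|/small->] //; rewrite (negbTE l0).
Qed.

Definition box (q k : nat) (x : 'I_q.+2) : 'I_k.+1 := inord ((k.+1 * x) %/ q.+2).

Lemma box_eq q k (x y : 'I_q.+2) :
  box k x = box k y -> (k.+1 * circ_norm (x - y)%R < q.+2)%N.
Proof.
wlog yx : x y / (y <= x)%N => [H|].
  have [/H//|/ltnW xy e] := leqP y x; rewrite -circ_normN opprB; exact: H.
move/(congr1 val); rewrite /= !inordK ?ltn_divLR ?ltn_pmul2l // => e.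
apply: leq_ltn_trans (leq_mul (leqnn _) (circ_norm_sub yx)) _.
have := divn_eq (k.+1 * x) q.+2; have := divn_eq (k.+1 * y) q.+2; rewrite e.
have := ltn_pmod (k.+1 * x) (ltn0Sn q.+1); rewrite mulnBr; lia.
Qed.

(** Dirichlet's pigeonhole argument: two of the [q.+2] dilations put every point in the same boxes,
    and [l] is their difference. Two precisions are provided, a fixed one for centres and one
    growing with the radius for [V]. *)
Lemma simultaneous_approximation q (A A' : {set 'I_q.+2}) (k k' : nat) :
    (k.+1 ^ #|A| * k'.+1 ^ #|A'| < q.+2)%N ->
  exists l : 'I_q.+2, [/\ l != 0,
    {in A, forall x, k.+1 * circ_norm (l * x)%R < q.+2}%N &
    {in A', forall x, k'.+1 * circ_norm (l * x)%R < q.+2}%N].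
Proof.
move=> small.
pose f (l : 'I_q.+2) : {ffun {x | x \in A} -> 'I_k.+1} * {ffun {x | x \in A'} -> 'I_k'.+1} :=
  ([ffun x => box k (l * val x)], [ffun x => box k' (l * val x)]).
have /injectivePn[l [l' ll' [/ffunP fA /ffunP fA']]] : ~~ injectiveb f.
  apply/injectiveP => /leq_card.
  by rewrite card_prod !card_ffun !card_sig !card_ord leqNgt small.
exists (l - l'); split; first by rewrite subr_eq0.
- move=> x xA; have := fA (exist _ x xA); rewrite !ffunE /= => /box_eq.
  by rewrite mulrBl.
- move=> x xA; have := fA' (exist _ x xA); rewrite !ffunE /= => /box_eq.
  by rewrite mulrBl.
Qed.

(* A dual stand-in for the set of sums of at most R elements of V and -V: closed
   under the same operations, and controlled by every dilation that makes V small. *)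
Definition ball (q : nat) (V : {set 'I_q.+2}) (R : nat) (x : 'I_q.+2) : bool :=
  [forall l, circ_norm (l * x)%R <= R * \max_(v in V) circ_norm (l * v)%R]%N.

Lemma ball_center q (V : {set 'I_q.+2}) R : ball V R 0.
Proof. by apply/forallP => l; rewrite mulr0 circ_norm0. Qed.

Lemma ballN q (V : {set 'I_q.+2}) R x : ball V R (- x) = ball V R x.
Proof. by apply: eq_forallb => l; rewrite mulrN circ_normN. Qed.

Lemma ballD q (V : {set 'I_q.+2}) R R' x y :
  ball V R x -> ball V R' y -> ball V (R + R') (x + y).
Proof.
move=> /forallP Vx /forallP Vy; apply/forallP => l; rewrite mulrDr mulnDl.
exact: leq_trans (circ_normD _ _) (leq_add (Vx l) (Vy l)).
Qed.

Lemma ballS q (V V' : {set 'I_q.+2}) R R' x :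
  V \subset V' -> (R <= R')%N -> ball V R x -> ball V' R' x.
Proof.
move=> /subsetP VV' RR' /forallP Vx; apply/forallP => l.
apply: leq_trans (Vx l) (leq_mul RR' _).
by apply/bigmax_leqP => v /VV' vV'; apply: leq_bigmax_cond.
Qed.

Lemma ball_gen q (V : {set 'I_q.+2}) v : v \in V -> ball V 1 v.
Proof. by move=> vV; apply/forallP => l; rewrite mul1n; apply: leq_bigmax_cond. Qed.

Lemma ball_small q (V : {set 'I_q.+2}) D R k (l x : 'I_q.+2) :
    {in V, forall v, D * R * circ_norm (l * v)%R < q.+2}%N -> ball V (k * R) x ->
  (D * circ_norm (l * x)%R <= k * q.+2)%N.
Proof.
move=> Vl /forallP/(_ l) h; apply: leq_trans (leq_mul (leqnn D) h) _.
have max_lt : (D * R * \max_(v in V) circ_norm (l * v)%R < q.+2)%N.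
  by elim/big_ind: _ => [|a b ha hb|v /Vl//]; rewrite ?muln0 // /maxn; case: ifP.
move: (\max_(v in V) _) max_lt => mx mx_lt.
have -> : (D * (k * R * mx) = k * (D * R * mx))%N by lia.
by rewrite leq_mul2l ltnW ?orbT.
Qed.

Lemma four_eighths_lt q : (4 * (q.+1 %/ 8) < q.+1)%N.
Proof. by have := leq_divM q.+1 8; lia. Qed.

(** In so short an arc addition behaves as in the integers, so twice the largest element is a unique
    sum. *)
Lemma rectified_unique_sum q (B : {set 'I_q.+2}) (l : 'I_q.+2) : prime q.+2 -> B != set0 -> l != 0 ->
  {in B, forall b, 8 * circ_norm (l * b)%R < q.+2}%N -> has_unique_sum B.
Proof.
move=> pq /set0Pn[b0 b0B] l0 Bl.
have Bh b : b \in B -> (circ_norm (l * b)%R <= q.+2 %/ 8)%N.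
  by move/Bl => h; rewrite leq_divRL // mulnC ltnW.
pose a := [arg max_(b > b0 in B) shifted_lift (q.+2 %/ 8) (l * b)%R].
have [aB amax] : a \in B /\ {in B, forall b,
    shifted_lift (q.+2 %/ 8) (l * b)%R <= shifted_lift (q.+2 %/ 8) (l * a)%R}%N.
  by rewrite /a; case: arg_maxnP.
exists a, a; split=> // x y xB yB e; left.
have [||||||||/(mul_ord_prime_inj pq l0)-> /(mul_ord_prime_inj pq l0)->] //:=
  @shifted_lift_dominated q (q.+2 %/ 8) (l * a) (l * a) (l * x) (l * y).
- exact: four_eighths_lt.
- exact: Bh.
- exact: Bh.
- exact: Bh.
- exact: Bh.
- by rewrite -!mulrDr e.
- exact: amax.
- exact: amax.
Qed.

(** * Covers by cells, and what the absence of a unique sum forces on them *)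

Lemma not_unique_sumP (G : finZmodType) (B : {set G}) : ~ has_unique_sum B ->
  {in B &, forall a b, exists c d,
    [/\ c \in B, d \in B, c + d = a + b, (c, d) != (a, b) & (c, d) != (b, a)]}.
Proof.
move=> nu a b aB bB.
have [/existsP[c /existsP[d /and5P[cB dB /eqP e n1 n2]]]|no] :=
  boolP [exists c, exists d, [&& c \in B, d \in B, c + d == a + b,
                              (c, d) != (a, b) & (c, d) != (b, a)]].
  by exists c, d.
case: nu; exists a, b; split=> // x y xB yB e.
move: no; rewrite negb_exists => /forallP/(_ x); rewrite negb_exists => /forallP/(_ y).
rewrite xB yB e eqxx /= -negb_or negbK => /orP[]/eqP[-> ->]; by [left|right].
Qed.

Definition covers (q : nat) (B T V : {set 'I_q.+2}) (R : nat) : Prop :=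
  {in B, forall b, exists2 t, t \in T & ball V R (b - t)}.

(** One dilation making [V] small orders all cells at once, each relative to its centre. By
    domination, the sum of two tops has no other representation with one term in each of the same
    two cells. *)
Lemma cell_tops q (B T V : {set 'I_q.+2}) R :
    prime q.+2 -> T \subset B -> covers B T V R -> ((64 * R.+1) ^ #|V| < q.+2)%N ->
  exists kappa top : 'I_q.+2 -> 'I_q.+2,
  [/\ {in B, forall b, kappa b \in T /\ ball V R (b - kappa b)},
      {in T, forall t, top t \in B /\ kappa (top t) = t} &
      {in B &, forall c d, c + d = top (kappa c) + top (kappa d) ->
                           c = top (kappa c) /\ d = top (kappa d)}].
Proof.
move=> pq TB cov small.
have [|l [l0 _ Vl]] := @simultaneous_approximation q set0 V 0 (64 * R.+1).-1.
  by rewrite cards0 mul1n prednK.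
rewrite prednK // in Vl.
(* Centres are sent to themselves so that every cell is nonempty and [top] has a valid starting
   point. The default [b] is never reached on [B]. *)
pose kappa b := if b \in T then b else odflt b [pick t in T | ball V R (b - t)].
have kappaP b : b \in B -> kappa b \in T /\ ball V R (b - kappa b).
  move=> bB; rewrite /kappa; have [bT|_] := boolP (b \in T).
    by rewrite subrr ball_center.
  case: pickP => [t /andP[] //|none]; have [t tT bt] := cov b bB.
  by have := none t; rewrite tT bt.
have kappaT t : t \in T -> kappa t = t by rewrite /kappa => ->.
pose h := (q.+2 %/ 8)%N.
pose top t := [arg max_(b > t | (b \in B) && (kappa b == t)) shifted_lift h (l * (b - t))].
have topP t : t \in T -> [/\ top t \in B, kappa (top t) = t & forall b, b \in B ->
    kappa b = t -> (shifted_lift h (l * (b - t))%R <= shifted_lift h (l * (top t - t))%R)%N].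
  move=> tT; rewrite /top; case: arg_maxnP.
    by rewrite (subsetP TB) // kappaT /=.
  move=> i /andP[iB /eqP it] imax; split=> // b bB bt; apply: imax.
  by rewrite bB bt /=.
exists kappa, top; split=> //; first by move=> t /topP[].
move=> c d cB dB e.
have [cT cR] := kappaP c cB; have [dT dR] := kappaP d dB.
have [tcB ktc ctop] := topP _ cT; have [tdB ktd dtop] := topP _ dT.
have norm_h b : b \in B -> (circ_norm (l * (b - kappa b))%R <= h)%N.
  move=> bB; have [_ bR] := kappaP b bB.
  have bR1 : ball V (1 * R.+1) (b - kappa b) by rewrite mul1n; apply: ballS bR.
  have n64 := ball_small Vl bR1; rewrite /h leq_divRL // mulnC -[leqRHS]mul1n.
  by apply: leq_trans n64; rewrite leq_mul2r orbT.
have [||||||||e1 e2] //:= @shifted_lift_dominated q h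
    (l * (top (kappa c) - kappa c)) (l * (top (kappa d) - kappa d))
    (l * (c - kappa c)) (l * (d - kappa d)).
- exact: four_eighths_lt.
- by rewrite -{2}ktc norm_h.
- by rewrite -{2}ktd norm_h.
- exact: norm_h.
- exact: norm_h.
- by rewrite -!mulrDr; congr (_ * _); rewrite addrACA e [RHS]addrACA.
- exact: ctop.
- exact: dtop.
by split; [move/(mul_ord_prime_inj pq l0): e1|move/(mul_ord_prime_inj pq l0): e2];
  apply: addIr.
Qed.

(** Each centre of [U] has a neighbour. Delete a third of [U], chosen so that the neighbours of
    deleted centres survive and absorb their cells; the radii add up. *)
Lemma thin_cover q (B T U V V' : {set 'I_q.+2}) R R' :
    covers B T V R -> V \subset V' -> U \subset T ->
    {in U, forall u, exists w, [/\ w \in T, w != u & ball V' R' (u - w)]} ->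
  exists T' : {set 'I_q.+2},
    [/\ T' \subset T, (3 * #|T'| + #|U| <= 3 * #|T|)%N & covers B T' V' (R + R')].
Proof.
move=> cov VV' UT near.
pose f u := odflt u [pick w in T | (w != u) && ball V' R' (u - w)].
have fP u : u \in U -> [/\ f u \in T, f u != u & ball V' R' (u - f u)].
  move=> /near[w [wT wu uw]]; rewrite /f; case: pickP => [x /and3P[]//|/(_ w)].
  by rewrite wT wu uw.
have [|A [AU Ubig fA]] := @large_shifted_subset _ U f; first by move=> u /fP[].
exists (T :\: A); split; first exact: subsetDl.
  have := cardsID A T; rewrite (setIidPr (subset_trans AU UT)); lia.
move=> b bB; have [t tT bt] := cov b bB.
have [tA|tA] := boolP (t \in A).
  have [ftT _ tft] := fP _ (subsetP AU t tA).
  exists (f t); first by rewrite inE fA.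
  by rewrite -(subrKA t b); apply: ballD => //; apply: ballS bt.
by exists t; [rewrite inE tA|apply: ballS bt => //; rewrite leq_addr].
Qed.

(** If [S] had at most [s] elements, one dilation would make both [S] and [V] small, hence all of
    [T], hence all of [B], and [rectified_unique_sum] would apply. *)
Lemma few_determine_all q (B T V S : {set 'I_q.+2}) R s :
    prime q.+2 -> B != set0 -> ~ has_unique_sum B -> covers B T V R ->
    (64 ^ s * (64 * R.+1) ^ #|V| < q.+2)%N ->
    {in T, forall t, t \in S \/ exists x y z,
      [/\ x \in S, y \in S, z \in S & ball V (4 * R) (t - (x + y - z))]} ->
  (s < #|S|)%N.
Proof.
move=> pq B0 nu cov small det; rewrite ltnNge; apply/negP => Ss; apply: nu.
have [|l [l0 Sl Vl]] := @simultaneous_approximation q S V 63 (64 * R.+1).-1.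
  rewrite prednK //; apply: leq_ltn_trans small.
  by rewrite leq_mul2r leq_pexp2l ?orbT.
rewrite prednK // in Vl.
apply: (rectified_unique_sum pq B0 l0) => b bB; have [t tT bt] := cov b bB.
have bt1 : ball V (1 * R.+1) (b - t) by rewrite mul1n; apply: ballS bt.
have lb : (circ_norm (l * b)%R <= circ_norm (l * (b - t))%R + circ_norm (l * t)%R)%N.
  by rewrite -{1}(subrK t b) [l * (_ + t)]mulrDr; apply: circ_normD.
(* In units of [q.+2] / 64, the points [x], [y], [z] cost 3, the error of radius [4 * R] costs 4 and
   [b - t] costs 1: in total 8, which is the arc allowed. *)
suff lt : (64 * circ_norm (l * t)%R < 7 * q.+2)%N.
  by have := ball_small Vl bt1; move: lb lt; clear; lia.
have [tS|[x [y [z [xS yS zS txyz]]]]] := det t tT.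
  by have := Sl t tS; clear; lia.
have txyz1 : ball V (4 * R.+1) (t - (x + y - z)).
  by apply: ballS txyz => //; rewrite leq_mul2l leqnSn orbT.
have := ball_small Vl txyz1; have := Sl x xS; have := Sl y yS; have := Sl z zS.
have -> : l * t = l * (t - (x + y - z)) + (l * x + l * y + - (l * z)).
  by rewrite -mulrDr -mulrBr -mulrDr subrK.
have := circ_normD (l * (t - (x + y - z))) (l * x + l * y + - (l * z)).
have := circ_normD (l * x + l * y) (- (l * z)); have := circ_normD (l * x) (l * y).
by rewrite circ_normN; clear; do 6! [let n := fresh in move: (circ_norm _) => n]; lia.
Qed.

(** * Thinning the cover *)

(** Three cases: many centres have close neighbours, and [V] need not grow; or the relations at some
    good centre are all met by a bounded set, whose differences enlarge [V]; or every good centre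
    has many disjoint relations, and sampling contradicts [few_determine_all]. *)
Lemma covering_step q (B T V : {set 'I_q.+2}) R m Q :
    prime q.+2 -> B != set0 -> ~ has_unique_sum B -> T \subset B -> covers B T V R ->
    (64 ^ (12 * m) * (64 * R.+1) ^ #|V| < q.+2)%N ->
    (#|T| <= 3 * m * Q.+1)%N -> (Q.+1 ^ 4 <= 2 * m)%N ->
  exists V' T' : {set 'I_q.+2},
    [/\ T' \subset B, (#|T'| + m <= #|T|)%N, (#|V'| <= #|V| + 3 * Q.+1 ^ 4)%N &
        covers B T' V' (5 * R).+1].
Proof.
move=> pq B0 nu TB cov small Tle Mle.
have Vsmall : ((64 * R.+1) ^ #|V| < q.+2)%N.
  by apply: leq_ltn_trans small; rewrite leq_pmull // expn_gt0.
have [kappa [top [kP tP topP]]] := cell_tops pq TB cov Vsmall.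
have Tbig : (12 * m < #|T|)%N.
  by apply: (few_determine_all pq B0 nu cov small) => t tT; left.
have kT b : b \in B -> kappa b \in T by case/kP.
have kR b : b \in B -> ball V R (b - kappa b) by case/kP.
have kR' b : b \in B -> ball V R (kappa b - b) by move/kR; rewrite -ballN opprB.
have tR t : t \in T -> ball V R (top t - t).
  by move=> /tP[tB kt]; rewrite -{2}kt kR.
have tR' t : t \in T -> ball V R (t - top t) by move/tR; rewrite -ballN opprB.
(* In a relation [c + d = top t + top u], if [c] is near [top t] then [d] is near [top u], and the
   centres [kappa d] and [u] are close. *)
have swap_close (V1 : {set 'I_q.+2}) R1 (t u c d : 'I_q.+2) : u \in T -> d \in B -> V \subset V1 ->
    c + d = top t + top u -> ball V1 R1 (c - top t) -> ball V1 (R1 + 2 * R) (u - kappa d).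
  move=> uT dB VV1 e ct.
  have -> : u - kappa d = (c - top t) + ((u - top u) + (d - kappa d)).
    have -> : c = top t + top u - d by rewrite -e addrK.
    by ring.
  apply: ballD => //; rewrite mul2n -addnn; apply: ballD.
    by apply: (ballS VV1 (leqnn R)); apply: tR'.
  by apply: (ballS VV1 (leqnn R)); apply: kR.
(* The radius [4 * R] is what [swap_close] gives for two points of a common cell, which are within
   [2 * R] of each other. *)
pose U := [set t in T | [exists u, [&& u \in T, u != t & ball V (4 * R) (t - u)]]].
have UT : U \subset T by apply/subsetP => t; rewrite inE => /andP[].
have [Ubig|Usmall] := leqP (3 * m) #|U|.
  have [|T' [T'T T'le T'cov]] := @thin_cover q B T U V V R (4 * R) cov (subxx _) UT.
    move=> u; rewrite inE => /andP[_ /existsP[w /and3P[wT wu uw]]]; by exists w.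
  exists V, T'; split; [exact: subset_trans TB| |exact: leq_addr|].
    by move: T'le Ubig; clear; lia.
  move=> b /T'cov[t tT' bt]; exists t => //; apply: ballS bt => //; clear; lia.
have good t u : t \in T :\: U -> u \in T -> ball V (4 * R) (t - u) -> u = t.
  rewrite !inE negb_and => /andP[/orP[/negP//|/existsPn no] tT] uT tu.
  by have := no u; rewrite uT tu andbT /= negbK => /eqP.
(* Requiring [kappa c] and [kappa d] to differ from [u] ensures that a centre found close to [u] is
   a different one. *)
pose edge t u c d := [&& u \in T :\: U, u != t, c \in B, d \in B,
  c + d == top t + top u, kappa c != u & kappa d != u].
pose F t := [pred e : {set 'I_q.+2} | [exists u, exists c, exists d,
   edge t u c d && (e == [set u; kappa c; kappa d])]].
have edgeP t u : t \in T :\: U -> u \in T :\: U -> u != t ->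
    exists c d, edge t u c d.
  move=> tW uW ut.
  have tT : t \in T by move: tW; rewrite inE => /andP[].
  have uT : u \in T by move: uW; rewrite inE => /andP[].
  have [ttB ktt] := tP t tT; have [tuB ktu] := tP u uT.
  have [c [d [cB dB e n1 n2]]] := not_unique_sumP nu ttB tuB.
  exists c, d; rewrite /edge uW ut cB dB e eqxx /=.
  have e' : d + c = top t + top u by rewrite addrC.
  (* With x in the cell of u, y - top t = top u - x is a short combination of V,
     so y lies in the cell of the good centre t and both are tops. *)
  have ctop x y : x \in B -> y \in B -> x + y = top t + top u -> kappa x = u ->
      x = top u /\ y = top t.
    move=> xB yB exy kx.
    have h : ball V (R + R + 2 * R) (t - kappa y).
      apply: (@swap_close V (R + R) u t x y) => //; first by rewrite exy addrC.
      rewrite -(subrKA u x); apply: ballD; last exact: tR'.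
      by rewrite -kx; apply: kR.
    have ky : kappa y = t.
      by apply: good tW (kT y yB) _; apply: ballS h => //; clear; lia.
    have [] := topP x y xB yB; first by rewrite kx ky exy addrC.
    by rewrite kx ky.
  apply/andP; split; apply/negP => /eqP ku.
    have [ec ed] := ctop c d cB dB e ku.
    by rewrite ec ed eqxx in n2.
  have [ec ed] := ctop d c dB cB e' ku.
  by rewrite ec ed eqxx in n1.
have F3 t e : F t e -> (#|e| <= 3)%N.
  case/existsP=> u /existsP[c /existsP[d /andP[_ /eqP->]]].
  apply: leq_trans (leq_card_setU _ _) _.
  by rewrite cards2 cards1 addn1 ltnS; case: (_ != _).
have [/exists_inP[t tW /existsP[C /andP[Cle /forallP hit]]]|nocover] :=
  boolP [exists t in T :\: U, exists C : {set 'I_q.+2},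
   (#|C| <= 3 * Q.+1 ^ 4)%N && [forall e, F t e ==> ~~ [disjoint e & C]]].
  have tT : t \in T by move: tW; rewrite inE => /andP[].
  pose V1 := V :|: [set x - t | x in C].
  pose U1 := T :\: (U :|: (t |: C)).
  have VV1 : V \subset V1 by apply: subsetUl.
  have U1T : U1 \subset T by apply: subsetDl.
  have [u|T' [T'T T'le T'cov]] := @thin_cover q B T U1 V V1 R (4 * R).+1 cov VV1 U1T.
    rewrite in_setD 2!in_setU in_set1 !negb_or -!andbA => /and4P[uU ut uC uT].
    have uW : u \in T :\: U by rewrite in_setD uU uT.
    have [c [d ecd]] := edgeP t u tW uW ut.
    have /implyP := hit [set u; kappa c; kappa d].
    have -> /= : F t [set u; kappa c; kappa d].
      by apply/existsP; exists u; apply/existsP; exists c; apply/existsP; exists d;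
        rewrite ecd eqxx.
    move=> /(_ isT) /pred0Pn[x /andP[/= xe xC]].
    case/and5P: ecd => _ _ cB dB /and3P[/eqP e kcu kdu].
    (* Since [kappa y - t] is now a generator, [y - top t] has radius [R + 1 + R], and [swap_close]
       adds [2 * R]. *)
    have key y z : y \in B -> z \in B -> y + z = top t + top u -> kappa y \in C ->
        ball V1 (4 * R).+1 (u - kappa z).
      move=> yB zB eyz kyC.
      have -> : ((4 * R).+1 = R + 1 + R + 2 * R)%N by clear; lia.
      apply: (@swap_close V1 _ t u y z) => //.
      rewrite -(subrKA t y); apply: ballD; last by apply: (ballS VV1 (leqnn R)); apply: tR'.
      rewrite -(subrKA (kappa y) y); apply: ballD.
        by apply: (ballS VV1 (leqnn R)); apply: kR.
      by apply: ball_gen; rewrite inE; apply/orP; right; apply/imsetP; exists (kappa y).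
    move: xe; rewrite !inE -orbA => /or3P[]/eqP ex; rewrite ex in xC.
    - by rewrite xC in uC.
    - by exists (kappa d); rewrite kT // kdu; split=> //; apply: (key c d).
    - by exists (kappa c); rewrite kT // kcu; split=> //; apply: (key d c) => //; rewrite addrC.
  exists V1, T'; split; [exact: subset_trans TB| | |].
  (* Of more than [12 * m] centres, fewer than [3 * m] lie in [U], at most [6 * m] in [C], and one
     is [t]; at least [3 * m] remain, so thinning removes at least [m]. *)
  - have := cardsID (U :|: (t |: C)) T; rewrite -/U1.
    have := subset_leq_card (subsetIr T (U :|: (t |: C))).
    have := (leq_card_setU U (t |: C)).1; rewrite cardsU1.
    by have := leq_b1 (t \notin C); move: T'le Usmall Cle Tbig Mle; clear; lia.
  - apply: leq_trans (leq_card_setU _ _) _; rewrite leq_add2l.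
    exact: leq_trans (leq_imset_card _ _) Cle.
  - move=> b /T'cov[x xT' bx]; exists x => //; apply: ballS bx => //; clear; lia.
have matchings t : exists es : seq {set 'I_q.+2}, t \in T :\: U ->
    [/\ size es = (Q.+1 ^ 4)%N, disjoint_family es & all (F t) es].
  have [tW|] := boolP (t \in T :\: U); last by exists [::].
  have [[es esP]|[C [Cle hit]]] := matching_or_cover (Q.+1 ^ 4) (F3 t).
    by exists es.
  case/exists_inP: nocover; exists t => //; apply/existsP; exists C.
  by rewrite Cle; apply/forallP => e; apply/implyP/hit.
have [es esP] := fin_all_exists matchings.
have [||S Sle] := @sampling _ Q T (T :\: U) es; first exact: subsetDl.
  move=> t /esP[? ? /allP esF]; split=> //; apply/allP => e /esF; exact: F3.
(* Sampling contributes at most [6 * m] centres and [U] fewer than [3 * m]. Any other [t] has a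
   relation inside [S], which gives [t] as [kappa c + kappa d - u] up to radius [4 * R]. *)
pose S' := (T :&: S) :|: (U :|: [set t in T :\: U | avoids (es t) S]).
suff : (12 * m < #|S'|)%N.
  have := (leq_card_setU (T :&: S) (U :|: [set t in T :\: U | avoids (es t) S])).1.
  have := (leq_card_setU U [set t in T :\: U | avoids (es t) S]).1; rewrite -/S'.
  have : (#|T :&: S| + #|[set t in T :\: U | avoids (es t) S]| <= 6 * m)%N.
    by rewrite -(leq_pmul2l (ltn0Sn Q)); move: Sle Tle; clear; lia.
  by move: Usmall; clear; lia.
apply: (few_determine_all pq B0 nu cov small) => t tT.
have [tS'|tS'] := boolP (t \in S'); [by left|right; move: tS'].
have [tU|tU] := boolP (t \in U); first by rewrite 2!in_setU tU orbT.
have tW : t \in T :\: U by rewrite inE tU.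
rewrite in_setU [t \in U :|: _]in_setU (negbTE tU) negb_or [t \in [set _ in _ | _]]inE tW.
case/andP=> _.
case/allPn => e ee; rewrite negbK => eS; have [_ _ /allP/(_ e ee)] := esP t tW.
case/existsP=> u /existsP[c /existsP[d /andP[/and5P[uW _ cB dB /and3P[/eqP ecd _ _]] /eqP ee']]].
have uT : u \in T by move: uW; rewrite inE => /andP[].
have inS x : x \in e -> x \in T -> x \in S' by move=> /(subsetP eS) xS xT; rewrite !inE xT xS.
exists (kappa c), (kappa d), u; split.
- by apply: inS (kT c cB); rewrite ee' !inE eqxx orbT.
- by apply: inS (kT d dB); rewrite ee' !inE eqxx orbT.
- by apply: inS uT; rewrite ee' !inE eqxx.
have -> : t - (kappa c + kappa d - u)
        = (t - top t) + (u - top u) + ((c - kappa c) + (d - kappa d)).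
  have -> : c = top t + top u - d by rewrite -ecd addrK.
  by ring.
have -> : (4 * R = (R + R) + (R + R))%N by clear; lia.
by apply: ballD; apply: ballD; rewrite ?tR' ?kR.
Qed.

(** Start from [T = B] with radius 1 and iterate [covering_step] with Q+1 = 48K, which matches the
    assumed bound 144Km on the size of [B]. The radius [6 ^ i] absorbs the growth from [R] to
    [5 * R + 1]. *)
Lemma no_unique_sum_card q (B : {set 'I_q.+2}) K m :
    prime q.+2 -> B != set0 -> ~ has_unique_sum B -> (2 ^ (144 * m) < q.+2)%N ->
    (0 < m)%N -> (0 < K)%N ->
    ((7 + 432 * K) * (3 * (48 * K) ^ 4 * (144 * K)) <= 72 * m)%N ->
  (144 * K * m < #|B|)%N.
Proof.
move=> pq B0 nu pbig m_gt0 K_gt0 Km; rewrite ltnNge; apply/negP => Ble.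
have Q1 : (48 * K).-1.+1 = (48 * K)%N by rewrite prednK // muln_gt0.
move eM: ((48 * K) ^ 4)%N Km => M Km.
have inv i : (i <= (144 * K).+1)%N -> exists V T : {set 'I_q.+2},
    [/\ T \subset B, (#|T| + i * m <= #|B|)%N, (#|V| <= 3 * M * i)%N &
        covers B T V (6 ^ i)].
  elim: i => [_|i IH iK].
    exists set0, B; split; rewrite ?cards0 ?addn0 // => b bB.
    by exists b; rewrite // subrr ball_center.
  have [V [T [TB Tle Vle cov]]] := IH (ltnW iK).
  have Vsmall : (64 ^ (12 * m) * (64 * (6 ^ i).+1) ^ #|V| < q.+2)%N.
    apply: leq_ltn_trans pbig.
    (* Half of the exponent pays for [12 * m] centres at precision 64, the other half for [V], whose
       precision is at most [2 ^ (7 + 3 * i)] with [i <= 144 * K]. *)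
    have -> : (144 * m = 6 * (12 * m) + 72 * m)%N by lia.
    rewrite expnD [(2 ^ (6 * _))%N]expnM leq_mul2l; apply/orP; right.
    have le2 : (64 * (6 ^ i).+1 <= 2 ^ (7 + 3 * i))%N.
      rewrite expnD [(2 ^ (3 * i))%N]expnM.
      have : (6 ^ i <= 8 ^ i)%N by case: (i) => // j; rewrite leq_exp2r.
      have : (0 < 6 ^ i)%N by rewrite expn_gt0.
      by change (2 ^ 7)%N with 128%N; change (2 ^ 3)%N with 8%N; clear; lia.
    apply: (@leq_trans ((2 ^ (7 + 3 * i)) ^ #|V|)).
      by case: #|V| => // v; rewrite leq_exp2r.
    rewrite -expnM leq_pexp2l //; apply: leq_trans Km; apply: leq_mul.
      by move: iK; clear; lia.
    by apply: leq_trans Vle _; rewrite leq_mul2l -ltnS iK orbT.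
  have Tle' : (#|T| <= 3 * m * (48 * K).-1.+1)%N by rewrite Q1; move: Tle Ble; clear; lia.
  have Mle : ((48 * K).-1.+1 ^ 4 <= 2 * m)%N.
    by rewrite Q1 eM; move: Km K_gt0; clear; nia.
  have [V' [T' [T'B T'le V'le cov']]] := covering_step pq B0 nu TB cov Vsmall Tle' Mle.
  exists V', T'; split=> //.
  - by rewrite mulSn; move: T'le Tle; clear; lia.
  - by rewrite mulnS; move: V'le Vle; rewrite Q1 eM; clear; lia.
  - move=> b /cov'[t tT' bt]; exists t => //; apply: ballS bt => //.
    have pos6 : (0 < 6 ^ i)%N by rewrite expn_gt0.
    by rewrite expnS; move: pos6; clear; lia.
(* After [(144 * K).+1] steps more centres would have been removed than [B] has elements. *)
have [V [T [_ Tle _ _]]] := inv _ (leqnn _).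
by move: Tle Ble m_gt0; rewrite mulSn; clear; lia.
Qed.

Local Close Scope ring_scope.

(** * Real estimates *)

From Stdlib Require Import Reals Lra.

Local Open Scope R_scope.

Lemma INR_addn (m n : nat) : INR (m + n)%nat = INR m + INR n.
Proof. exact: plus_INR. Qed.

Lemma INR_muln (m n : nat) : INR (m * n)%nat = INR m * INR n.
Proof. exact: mult_INR. Qed.

Lemma INR_expn (m n : nat) : INR (expn m n) = INR m ^ n.
Proof. by elim: n => // n IH; rewrite expnS INR_muln IH. Qed.

Lemma leq_INR (m n : nat) : (m <= n)%nat <-> INR m <= INR n.
Proof. by split=> [/leP/le_INR|/INR_le/leP]. Qed.

Lemma ltn_INR (m n : nat) : (m < n)%nat <-> INR m < INR n.
Proof. by split=> [/ltP/lt_INR|/INR_lt/ltP]. Qed.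

Lemma nat_floor x : 0 <= x -> exists n : nat, INR n <= x < INR n + 1.
Proof.
move=> x_ge0; have [up_gt up_le] := archimed x.
have up_gt0 : (0 < up x)%Z by apply: lt_IZR; lra.
have [n en] : exists n, (up x - 1)%Z = Z.of_nat n by apply: IZN; lia.
have {}en : IZR (up x) - 1 = INR n by rewrite INR_IZR_INZ -en minus_IZR.
by exists n; lra.
Qed.

Lemma ln_le x y : 0 < x -> x <= y -> ln x <= ln y.
Proof.
move=> x_gt0 [xy|->]; last exact: Rle_refl.
exact/Rlt_le/ln_increasing.
Qed.

(** The exponent 7 is one more than the degree 6 in K of the condition on [m] in
    [no_unique_sum_card]. *)
Lemma pow7_le_exp y : 0 <= y -> (y / 7) ^ 7 <= exp y.
Proof.
move=> y_ge0; have -> : exp y = exp (y / 7) ^ 7.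
  by rewrite /= Rmult_1_r -!exp_plus; congr exp; field.
by apply: pow_incr; have := exp_ineq1_le (y / 7); lra.
Qed.

Lemma lnln_eventually Y : exists N, forall n, (N <= n)%nat -> Y <= ln (ln (INR n)).
Proof.
have e1 := exp_pos Y; have [N [_ NY]] := nat_floor (Rlt_le _ _ (exp_pos (exp Y))).
exists N.+1 => n /leq_INR; rewrite S_INR => Nn.
rewrite -[Y]ln_exp; apply: ln_le => //.
rewrite -[exp Y]ln_exp; apply: ln_le; [exact: exp_pos|lra].
Qed.

(** With [y] equal to ln ln n, this shows that the bound proved exceeds the required rate, with
    constant 1. *)
Lemma sqrt_ln_div_lnln_le y : exp 3 <= y -> sqrt (ln y) / ln (ln y) <= y.
Proof.
move=> y3; have e3 := exp_pos 3.
have z3 : 3 <= ln y by rewrite -[3]ln_exp; apply: ln_le.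
have w1 : 1 <= ln (ln y).
  by rewrite -[1]ln_exp; apply: ln_le; [exact: exp_pos|have := exp_le_3; lra].
have s1 : sqrt (ln y) <= ln y.
  rewrite -{2}[ln y]sqrt_Rsqr; last lra.
  by apply: sqrt_le_1_alt; rewrite /Rsqr; nra.
have zy : ln y <= y.
  have := exp_ineq1_le (ln y); rewrite exp_ln; lra.
have s0 := sqrt_pos (ln y).
apply: Rle_trans zy; apply: Rle_trans s1.
rewrite -[X in _ <= X]Rmult_1_r; apply: Rmult_le_compat_l => //.
rewrite -Rinv_1; apply: Rinv_le_contravar; lra.
Qed.

Lemma card_ge_lnln q (B : {set 'I_q.+2}) :
    prime q.+2 -> B != set0 -> ~ has_unique_sum B -> 10 ^ 22 <= ln (ln (INR q.+2)) ->
  ln (ln (INR q.+2)) * ln (INR q.+2) <= INR #|B|.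
Proof.
move=> pq B0 nu; set p := INR q.+2; set y := ln (ln p) => y_big.
have p_gt1 : 1 < p by rewrite /p -[1]/(INR 1); apply/ltn_INR.
have x_gt0 : 0 < ln p by rewrite -ln_1; apply: ln_increasing; lra.
have ey : exp y = ln p by rewrite exp_ln.
have y_ge0 : 0 <= y by lra.
have y_pow := pow7_le_exp y_ge0; rewrite ey in y_pow.
set x := ln p in x_gt0 ey y_pow *.
(* The choice of [m] makes [2 ^ (144 * m)] less than p, and K is taken as [k.+1], just above
   [2 * y]. The factor 2 absorbs the rounding of [m], because [2 * (x - 144)] is at least [x] once
   [x] is at least 288. *)
have [m [m_le m_gt]] : exists m : nat, INR m <= x / 144 < INR m + 1 by apply: nat_floor; lra.
have [k [k_le k_gt]] : exists k : nat, INR k <= 2 * y < INR k + 1 by apply: nat_floor; lra.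
have xy6 : 10 ^ 16 * y ^ 6 <= x.
  apply: Rle_trans y_pow.
  have -> : (y / 7) ^ 7 = y / 7 ^ 7 * y ^ 6 by field.
  by apply: Rmult_le_compat_r; [apply: pow_le|lra].
have y6 : 1 <= y ^ 6 by apply: pow_R1_Rle; lra.
have m_gt0 : (0 < m)%nat by apply/ltn_INR; rewrite /=; lra.
have N144 : INR 144 = 144 by rewrite INR_IZR_INZ.
have p_large : (expn 2 (144 * m) < q.+2)%nat.
  apply/ltn_INR; rewrite INR_expn -/p -[p]exp_ln; last by lra.
  rewrite -Rpower_pow ?INR_muln ?N144; last by rewrite /=; lra.
  apply: exp_increasing; rewrite -/x.
  have ln2 : ln 2 < 1.
    rewrite -[1]ln_exp; apply: ln_increasing; [lra|have := exp_ineq1 1; lra].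
  have : 0 < INR m by apply: (ltn_INR 0 m).1.
  have -> : INR 2 = 2 by rewrite INR_IZR_INZ.
  by nra.
have m_large : ((7 + 432 * k.+1) * (3 * expn (48 * k.+1) 4 * (144 * k.+1)) <= 72 * m)%nat.
  apply/leq_INR; rewrite !(INR_muln, INR_addn, INR_expn) (S_INR k).
  have -> : INR 7 = 7 by rewrite INR_IZR_INZ.
  have -> : INR 432 = 432 by rewrite INR_IZR_INZ.
  have -> : INR 3 = 3 by rewrite INR_IZR_INZ.
  have -> : INR 48 = 48 by rewrite INR_IZR_INZ.
  have -> : INR 72 = 72 by rewrite INR_IZR_INZ.
  rewrite N144; set K := INR k + 1.
  have K1 : 1 <= K by rewrite /K; have := pos_INR k; lra.
  have Ky : K <= 3 * y by rewrite /K; lra.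
  have K6 : K ^ 6 <= 729 * y ^ 6.
    have -> : 729 * y ^ 6 = (3 * y) ^ 6 by ring.
    by apply: pow_incr; lra.
  apply: (@Rle_trans _ (439 * K * (3 * (48 * K) ^ 4 * (144 * K)))).
    apply: Rmult_le_compat_r; last by lra.
    have : 0 <= (48 * K) ^ 4 by apply: pow_le; lra.
    by move=> ?; apply: Rmult_le_pos; lra.
  have -> : 439 * K * (3 * (48 * K) ^ 4 * (144 * K)) = 439 * 3 * 144 * 48 ^ 4 * K ^ 6 by ring.
  lra.
have /ltn_INR := no_unique_sum_card pq B0 nu p_large m_gt0 (ltn0Sn k) m_large.
rewrite !INR_muln N144 (S_INR k) => Bgt.
have : 144 * (INR k + 1) * INR m >= y * x; last by lra.
have x288 : 288 <= x by lra.
have : 2 * y * (x - 144) <= (INR k + 1) * (144 * INR m).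
  by apply: Rmult_le_compat; lra.
nra.
Qed.

Local Close Scope R_scope.

(** The empty set has no unique sum in the sense of [has_unique_sum], hence the restriction to
    nonempty [B]. *)
Theorem theorem1p4 :
  exists omega : nat -> R,
    (forall n, (0 < omega n)%R) /\
    (forall M : R, exists N : nat, forall n : nat, (N <= n)%N -> (M <= omega n)%R) /\
    (exists c : R, (0 < c)%R /\
       exists N : nat, forall n : nat, (N <= n)%N ->
         (c * (sqrt (ln (ln (ln (INR n)))) / ln (ln (ln (ln (INR n))))) <= omega n)%R) /\
    (forall p : nat, prime p ->
       forall B : {set 'Z_p}, B != set0 -> ~ has_unique_sum B ->
         (omega p * ln (INR p) <= INR #|B|)%R).
Proof.
pose Y0 : R := (10 ^ 22)%R.
have Y0_gt0 : (0 < Y0)%R by rewrite /Y0; lra.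
(* Below the threshold ln p is less than exp Y0, so the constant exp (- Y0) makes the claimed bound
   less than 1, and [B] is nonempty. *)
pose omega n := if Rle_dec Y0 (ln (ln (INR n))) then ln (ln (INR n)) else exp (- Y0).
have omegaE n : (Y0 <= ln (ln (INR n)))%R -> omega n = ln (ln (INR n)).
  by rewrite /omega; case: (Rle_dec Y0 _).
have omegaN n : ~ (Y0 <= ln (ln (INR n)))%R -> omega n = exp (- Y0).
  by rewrite /omega; case: (Rle_dec Y0 _).
exists omega; split=> [n|].
  have [large|small] := Rle_dec Y0 (ln (ln (INR n))); first by rewrite omegaE //; lra.
  by rewrite omegaN //; apply: exp_pos.
split=> [M|].
  have [N largeN] := lnln_eventually (Rmax M Y0).
  exists N => n /largeN large; have := Rmax_l M Y0; have := Rmax_r M Y0 => ? ?.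
  by rewrite omegaE; lra.
split.
  exists 1%R; split; first lra.
  have [N largeN] := lnln_eventually (Rmax (exp 3) Y0).
  exists N => n /largeN large; have := Rmax_l (exp 3) Y0; have := Rmax_r (exp 3) Y0 => ? ?.
  have largeY0 : (Y0 <= ln (ln (INR n)))%R by lra.
  by rewrite (omegaE n largeY0) Rmult_1_l; apply: sqrt_ln_div_lnln_le; lra.
(* For [p = q.+2] the type ['Z_p] is convertible to ['I_q.+2]. *)
case=> [|[|q]] // pq B B0 nu.
have [large|small] := Rle_dec Y0 (ln (ln (INR q.+2))).
  by rewrite omegaE //; apply: card_ge_lnln.
rewrite omegaN //.
have B1 : (1 <= INR #|B|)%R.
  by rewrite -[1%R]/(INR 1); apply/leq_INR; rewrite card_gt0.
have p_gt1 : (1 < INR q.+2)%R by rewrite -[1%R]/(INR 1); apply/ltn_INR.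
have x_gt0 : (0 < ln (INR q.+2))%R by rewrite -ln_1; apply: ln_increasing; lra.
have x_lt : (ln (INR q.+2) < exp Y0)%R.
  by rewrite -[ln _]exp_ln //; apply: exp_increasing; lra.
apply: Rle_trans B1.
rewrite -[X in (_ <= X)%R]exp_0 -(Rplus_opp_l Y0) exp_plus.
by apply: Rmult_le_compat_l; [apply/Rlt_le/exp_pos|lra].
Qed.
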